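(* Let $\widetilde{\mathscr{C}}$ be the empirical GraField kernel of a graph $\mathcal G$ on $n$ vertices, and let $\eta_1,\dots,\eta_n$ be the degree-adaptive block-pulse functions $$\eta_j(u)=\widetilde p(j)^{-1/2}\ \text{ for } u_{j-1}<u\le u_j,\qquad \eta_j(u)=0\ \text{ elsewhere},\qquad u_j=\sum_{x\le j}\widetilde p(x),\ u_0=0 .$$ For $\theta\in\mathbb R^n$ and $\lambda\in\mathbb R$, the block-pulse series $\phi=\sum_{j=1}^n\theta_j\eta_j$ satisfies $$\int_0^1\big[\widetilde{\mathscr{C}}(u,v)-1\big]\phi(v)\,dv=\lambda\,\phi(u)\quad\text{for a.e. }u\in[0,1]$$ if and only if $$\mathcal L^*\theta=\lambda\theta,\qquad \mathcal L^*=\mathcal L-ww^{T},$$ where $\mathcal L=D^{-1/2}AD^{-1/2}$ is the (normalized) Laplacian matrix, $w=D_{\widetilde p}^{1/2}1_n$, $D_{\widetilde p}=\mathrm{diag}(\widetilde p(1),\dots,\widetilde p(n))$, and $1_n$ is the all-ones vector.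
   Context: $\mathcal G$ is an undirected, possibly weighted, graph with vertex set $\{1,\dots,n\}$ and symmetric adjacency matrix $A$ with nonnegative entries; $d_x=\sum_yA(x,y)$ is the degree of $x$, assumed positive for every $x$; $D=\mathrm{diag}(d_1,\dots,d_n)$; $N=\sum_{x,y}A(x,y)$. The paper's convention is to call $\mathcal L=D^{-1/2}AD^{-1/2}$ the graph Laplacian. The empirical (plug-in) estimates are $\widetilde P(x,y)=A(x,y)/N$ and $\widetilde p(x)=d_x/N$. With $F(x)=\sum_{y\le x}\widetilde p(y)$ and $Q(u)=\min\{x:F(x)\ge u\}$ for $0<u<1$, the empirical GraField kernel is $\widetilde{\mathscr{C}}(u,v)=\widetilde P(Q(u),Q(v))/\big(\widetilde p(Q(u))\widetilde p(Q(v))\big)$, $0<u,v<1$. *)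

(* Defs.v *)
From mathcomp Require Import all_boot all_order all_algebra.
From mathcomp Require Import all_classical all_reals all_analysis.

Set Implicit Arguments.
Unset Strict Implicit.
Unset Printing Implicit Defensive.

Import Order.TTheory GRing.Theory Num.Theory.
Import numFieldNormedType.Exports.

Local Open Scope classical_set_scope.
Local Open Scope ring_scope.

(* A graph on n.+1 >= 1 vertices is given by its weighted adjacency matrix
   A : 'M_n.+1; the vertex called x in 1..n.+1 on paper is x - 1 : 'I_n.+1. *)

Definition degree (R : realType) (n : nat) (A : 'M[R]_n.+1) (x : 'I_n.+1) : R :=
  \sum_y A x y.

Definition total_weight (R : realType) (n : nat) (A : 'M[R]_n.+1) : R :=
  \sum_x \sum_y A x y.

Definition emp_joint (R : realType) (n : nat) (A : 'M[R]_n.+1)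
    (x y : 'I_n.+1) : R :=
  A x y / total_weight A.

Definition emp_marg (R : realType) (n : nat) (A : 'M[R]_n.+1)
    (x : 'I_n.+1) : R :=
  degree A x / total_weight A.

Definition emp_cdf (R : realType) (n : nat) (A : 'M[R]_n.+1)
    (x : 'I_n.+1) : R :=
  \sum_(y < n.+1 | (y <= x)%N) emp_marg A y.

(* Q(u) = min {x : F(x) >= u}. The default ord_max belongs to this set for
   every u <= 1, because F(ord_max) = 1; it is a junk value only for u > 1. *)
Definition emp_quantile (R : realType) (n : nat) (A : 'M[R]_n.+1)
    (u : R) : 'I_n.+1 :=
  [arg min_(x < (ord_max : 'I_n.+1) | (u <= emp_cdf A x)%R) (x : nat)]%N.

Definition grafield (R : realType) (n : nat) (A : 'M[R]_n.+1) (u v : R) : R :=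
  let x := emp_quantile A u in
  let y := emp_quantile A v in
  emp_joint A x y / (emp_marg A x * emp_marg A y).

(* u_j for j = 0, ..., n.+1, the sum of the first j marginals; u_0 = 0. *)
Definition knot (R : realType) (n : nat) (A : 'M[R]_n.+1) (j : nat) : R :=
  \sum_(x < n.+1 | (x < j)%N) emp_marg A x.

(* Because vertices are numbered from 0, the block of j is ]u_j, u_(j+1)]. *)
Definition block_pulse (R : realType) (n : nat) (A : 'M[R]_n.+1)
    (j : 'I_n.+1) (u : R) : R :=
  if knot A j < u <= knot A j.+1 then (Num.sqrt (emp_marg A j))^-1 else 0.

Definition block_pulse_series (R : realType) (n : nat) (A : 'M[R]_n.+1)
    (theta : 'cV[R]_n.+1) (u : R) : R :=
  \sum_j theta j ord0 * block_pulse A j u.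

(* Here "Laplacian" means D^(-1/2) A D^(-1/2) itself, not 1 minus it. *)
Definition laplacian (R : realType) (n : nat) (A : 'M[R]_n.+1) : 'M[R]_n.+1 :=
  let Dm12 := diag_mx (\row_x (Num.sqrt (degree A x))^-1) in
  Dm12 *m A *m Dm12.

Definition sqrt_marg_vec (R : realType) (n : nat) (A : 'M[R]_n.+1) :
    'cV[R]_n.+1 :=
  diag_mx (\row_x Num.sqrt (emp_marg A x)) *m const_mx 1.

Definition laplacian_star (R : realType) (n : nat) (A : 'M[R]_n.+1) :
    'M[R]_n.+1 :=
  laplacian A - sqrt_marg_vec A *m (sqrt_marg_vec A)^T.

(* Main.v *)
Require Import Defs.
From mathcomp Require Import all_boot all_order all_algebra.
From mathcomp Require Import all_classical all_reals all_analysis.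
From mathcomp Require Import ring.

Import Order.TTheory GRing.Theory Num.Theory.
Import numFieldNormedType.Exports.

Local Open Scope classical_set_scope.
Local Open Scope ring_scope.

(** The integral operator with kernel [grafield A - 1], applied to a block-pulse
    series, is again a block-pulse series, and on coefficients it acts as
    [laplacian_star A].

    Indeed the blocks ]u_j, u_(j+1)] partition ]0, 1], block [j] has length
    p(j), and the quantile transform Q is constantly [j] on it
    ([emp_quantile_block], [emp_quantile_mem]).  For a fixed [u] the integrand
    is therefore a step function of [v] with value
    (C(u, .) - 1) theta_j p(j)^(-1/2) on block [j], so that its integral is
    sum_j (P(x,j) / (p(x) p(j)) - 1) theta_j p(j)^(1/2) with x = Q(u).  Since
    d_x = N p(x), this is p(x)^(-1/2) times the [x]-th entry of
    [laplacian_star A *m theta] ([grafield_integral]).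

    On block [x] the series itself is p(x)^(-1/2) theta_x, so there the integral
    equation says exactly that entry [x] of [laplacian_star A *m theta] is
    lambda theta_x.  The matrix equation thus gives the integral equation on
    ]0, 1], that is, off the null set {0}.  Conversely, every block has positive
    measure, so an almost everywhere identity holds at some point of each block,
    which yields every entry of the matrix equation. *)

(** * The blocks and the quantile transform *)

Lemma total_weight_gt0 {R : realType} {n : nat} {A : 'M[R]_n.+1}
    (dA : forall x, 0 < degree A x) : 0 < total_weight A.
Proof.
rewrite /total_weight big_ord_recl ltr_pwDl ?sumr_ge0 //.
  exact: dA.
by move=> i _; apply/ltW/dA.
Qed.

Lemma emp_marg_gt0 {R : realType} {n : nat} {A : 'M[R]_n.+1}
    (dA : forall x, 0 < degree A x) x : 0 < emp_marg A x.
Proof. by rewrite divr_gt0 // total_weight_gt0. Qed.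

Lemma emp_cdf_knot {R : realType} {n : nat} (A : 'M[R]_n.+1) x :
  emp_cdf A x = knot A x.+1.
Proof. by []. Qed.

Lemma knot0 {R : realType} {n : nat} (A : 'M[R]_n.+1) : knot A 0 = 0.
Proof. by rewrite /knot big_pred0. Qed.

Lemma knotS {R : realType} {n : nat} (A : 'M[R]_n.+1) (j : 'I_n.+1) :
  knot A j.+1 = knot A j + emp_marg A j.
Proof.
rewrite /knot (bigD1 j) //= addrC; congr (_ + _).
by apply: eq_bigl => i; rewrite ltnS [RHS]ltn_neqAle andbC.
Qed.

Lemma knot_last {R : realType} {n : nat} {A : 'M[R]_n.+1}
    (dA : forall x, 0 < degree A x) : knot A n.+1 = 1.
Proof.
rewrite /knot (eq_bigl xpredT) => [|i]; last by rewrite ltn_ord.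
by rewrite -mulr_suml divff // gt_eqF // total_weight_gt0.
Qed.

Lemma knot_le {R : realType} {n : nat} {A : 'M[R]_n.+1}
    (dA : forall x, 0 < degree A x) (i j : nat) :
  (i <= j)%N -> knot A i <= knot A j.
Proof.
move=> ij; rewrite /knot [leRHS](bigID (fun x : 'I_n.+1 => (x < i)%N)) /=.
under [X in _ <= X + _]eq_bigl => x.
  by rewrite andb_idl; [over|move=> /leq_trans; apply].
by rewrite lerDl sumr_ge0 // => x _; apply/ltW/emp_marg_gt0.
Qed.

(** F(j) is the right end of block j, so it bounds u, while F at any vertex
    before j is at most the left end of the block, which u exceeds. *)
Lemma emp_quantile_block {R : realType} {n : nat} {A : 'M[R]_n.+1}
    (dA : forall x, 0 < degree A x) {j : 'I_n.+1} {u : R} :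
  knot A j < u <= knot A j.+1 -> emp_quantile A u = j.
Proof.
move=> /andP[ju uj].
have u1 : u <= emp_cdf A ord_max.
  by rewrite emp_cdf_knot (le_trans uj) // knot_le.
rewrite /emp_quantile; case: arg_minnP => // i ui imin.
apply/val_inj/eqP; rewrite eqn_leq imin //= leqNgt; apply/negP => ij.
by move: ui; rewrite emp_cdf_knot leNgt (le_lt_trans _ ju) // knot_le.
Qed.

(** Minimality of Q(u) says that u exceeds the previous value of the distribution
    function, so u lies in the block of Q(u). *)
Lemma emp_quantile_mem {R : realType} {n : nat} {A : 'M[R]_n.+1}
    (dA : forall x, 0 < degree A x) {u : R} :
  0 < u <= 1 ->
  knot A (emp_quantile A u) < u <= knot A (emp_quantile A u).+1.
Proof.
move=> /andP[u0 u1].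
have ub : u <= emp_cdf A ord_max by rewrite emp_cdf_knot knot_last.
rewrite /emp_quantile; case: arg_minnP => // i ui imin.
rewrite -emp_cdf_knot ui andbT; case: i => -[|i] lti /= in ui imin *.
  by rewrite knot0.
rewrite ltNge; apply/negP => ui'.
by have := imin (Ordinal (ltnW lti)) ui'; rewrite /= ltnn.
Qed.

Lemma block_pulse_series_block {R : realType} {n : nat} {A : 'M[R]_n.+1}
    (dA : forall x, 0 < degree A x) (theta : 'cV[R]_n.+1)
    {j : 'I_n.+1} {u : R} :
  knot A j < u <= knot A j.+1 ->
  block_pulse_series A theta u = theta j ord0 / Num.sqrt (emp_marg A j).
Proof.
move=> uj; rewrite /block_pulse_series (bigD1 j) //=.
rewrite big1 => [|i ij]; first by rewrite addr0 /block_pulse uj.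
rewrite /block_pulse ifF ?mulr0 //; apply/negbTE; apply: contraNN ij => ui.
by rewrite -(emp_quantile_block dA ui) (emp_quantile_block dA uj).
Qed.

Lemma lebesgue_measure_block {R : realType} {n : nat} {A : 'M[R]_n.+1}
    (dA : forall x, 0 < degree A x) (j : 'I_n.+1) :
  lebesgue_measure `]knot A j, knot A j.+1]%classic = (emp_marg A j)%:E.
Proof.
rewrite lebesgue_measure_itv /= lte_fin knotS.
by rewrite ltrDl emp_marg_gt0 // -EFinB addrAC subrr add0r.
Qed.

Lemma block_sub01 {R : realType} {n : nat} {A : 'M[R]_n.+1}
    (dA : forall x, 0 < degree A x) (j : 'I_n.+1) :
  `]knot A j, knot A j.+1] `<=` `[0, 1].
Proof.
move=> u /=; rewrite !in_itv /= => /andP[ju uj].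
rewrite (le_trans _ (ltW ju)) -?(knot0 A) ?knot_le //=.
by rewrite (le_trans uj) // -(knot_last dA) knot_le.
Qed.

(** * The integral operator on step functions *)

Lemma integral_step {R : realType} {n : nat} {A : 'M[R]_n.+1}
    (dA : forall x, 0 < degree A x) (c : 'I_n.+1 -> R) :
  (\int[@lebesgue_measure R]_(v in `[0%R, 1%R])
     (\sum_j c j * \1_(`]knot A j, knot A j.+1]%classic) v)%:E
   = (\sum_j c j * emp_marg A j)%:E)%E.
Proof.
have mB (j : 'I_n.+1) : measurable (`]knot A j, knot A j.+1]%classic : set R).
  exact: measurable_itv.
have iB (j : 'I_n.+1) : (@lebesgue_measure R).-integrable `[0, 1]
    (fun v => (\1_(`]knot A j, knot A j.+1]%classic) v)%:E).
  by apply: (integrableS measurableT) => //; exact: integrable_indic_itv.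
under eq_integral do rewrite -sumEFin.
rewrite integral_sum //; last first.
  by move=> j; exact: (integrableZl _ (c j) (iB j)).
rewrite -sumEFin; apply: eq_bigr => j _.
under eq_integral do rewrite EFinM.
rewrite integralZl // integral_indic // (setIidl (block_sub01 dA j)).
by rewrite [RHS]EFinM; congr (_ * _)%E; exact: lebesgue_measure_block.
Qed.

Lemma laplacian_star_mulE {R : realType} {n : nat} (A : 'M[R]_n.+1)
    (theta : 'cV[R]_n.+1) (x : 'I_n.+1) :
  (laplacian_star A *m theta) x ord0 =
  \sum_j ((Num.sqrt (degree A x))^-1 * A x j * (Num.sqrt (degree A j))^-1
          - Num.sqrt (emp_marg A x) * Num.sqrt (emp_marg A j)) * theta j ord0.
Proof.
rewrite mxE; apply: eq_bigr => j _; congr (_ * _).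
rewrite /laplacian_star /laplacian /sqrt_marg_vec /=.
by rewrite mul_mx_diag !mul_diag_mx !(mxE, big_ord1) !mulr1.
Qed.

(** The integral depends on u only through Q(u), and the formula holds at
    u = 0 too: the exceptional null set of the eigenvalue equation comes from the
    series on its right-hand side, not from the integral. *)
Lemma grafield_integral {R : realType} {n : nat} {A : 'M[R]_n.+1}
    (dA : forall x, 0 < degree A x)
    (theta : 'cV[R]_n.+1) (u : R) :
  (\int[@lebesgue_measure R]_(v in `[0%R, 1%R])
     ((grafield A u v - 1) * block_pulse_series A theta v)%:E
   = ((laplacian_star A *m theta) (emp_quantile A u) ord0
      / Num.sqrt (emp_marg A (emp_quantile A u)))%:E)%E.
Proof.
set x := emp_quantile A u.
pose c j := (emp_joint A x j / (emp_marg A x * emp_marg A j) - 1)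
            * (theta j ord0 / Num.sqrt (emp_marg A j)).
under eq_integral => v _.
  (* Off the j-th block both sides of the j-th summand vanish, so the value of
     the kernel matters only where the quantile of v is j. *)
  rewrite (_ : _ * _ =
    \sum_j c j * \1_(`]knot A j, knot A j.+1]%classic) v); last first.
    rewrite /block_pulse_series mulr_sumr; apply: eq_bigr => j _.
    rewrite /block_pulse indicE; case: ifPn => vj.
      rewrite mem_set ?mulr1 /= ?in_itv //.
      by rewrite /c /grafield (emp_quantile_block dA vj).
    by rewrite memNset ?mulr0 //= in_itv; apply/negP.
  over.
rewrite integral_step //; congr EFin.
rewrite laplacian_star_mulE mulr_suml; apply: eq_bigr => j _.
have N0 := total_weight_gt0 dA.
(* With d_i = N p(i), everything is a rational function of the three square
   roots of N, p(x) and p(j). *)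
have degE i : Num.sqrt (degree A i)
    = Num.sqrt (total_weight A) * Num.sqrt (emp_marg A i).
  by rewrite -sqrtrM ?(ltW N0) // mulrC divfK // gt_eqF.
have sN0 : Num.sqrt (total_weight A) != 0 by rewrite gt_eqF ?sqrtr_gt0.
have sp0 i : Num.sqrt (emp_marg A i) != 0.
  by rewrite gt_eqF ?sqrtr_gt0 ?emp_marg_gt0.
have NE : total_weight A = Num.sqrt (total_weight A) ^+ 2.
  by rewrite sqr_sqrtr // ltW.
have pE i : emp_marg A i = Num.sqrt (emp_marg A i) ^+ 2.
  by rewrite sqr_sqrtr // ltW // emp_marg_gt0.
rewrite /c /emp_joint !degE.
move: (sp0 x) (sp0 j) sN0 (pE x) (pE j) NE.
move: (Num.sqrt (emp_marg A x)) (Num.sqrt (emp_marg A j)).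
move: (Num.sqrt (total_weight A)) => s a b a0 b0 s0 -> -> ->.
by field; apply/and3P.
Qed.

(** * The eigenvalue equation *)

Theorem theorem5 (R : realType) (n : nat) (A : 'M[R]_n.+1)
    (A_sym : A^T = A)
    (A_ge0 : forall x y, 0 <= A x y)
    (deg_gt0 : forall x, 0 < degree A x)
    (theta : 'cV[R]_n.+1) (lambda : R) :
  {ae @lebesgue_measure R, forall u : R, `[0, 1]%classic u ->
     (\int[@lebesgue_measure R]_(v in `[0%R, 1%R])
        ((grafield A u v - 1) * block_pulse_series A theta v)%:E
      = (lambda * block_pulse_series A theta u)%:E)%E}
  <-> laplacian_star A *m theta = lambda *: theta.
Proof.
split=> [ae_eq|eigen].
- apply/colP => x; rewrite [RHS]mxE.
  have sx0 : (Num.sqrt (emp_marg A x))^-1 != 0.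
    by rewrite invr_neq0 // gt_eqF // sqrtr_gt0 emp_marg_gt0.
  (* Otherwise the equation fails on the whole block of x, which has positive
     measure. *)
  apply: contrapT => neq.
  have : (@lebesgue_measure R).-negligible `]knot A x, knot A x.+1].
    apply: negligibleS ae_eq => u xu /= eq_u; apply: neq.
    have := eq_u (block_sub01 deg_gt0 x _ xu).
    move: xu; rewrite /= in_itv /= => xu.
    rewrite (grafield_integral deg_gt0) (emp_quantile_block deg_gt0 xu).
    rewrite (block_pulse_series_block deg_gt0 _ xu) mulrA => -[].
    exact: (mulIf sx0).
  move=> /measure_negligible => /(_ (measurable_itv _)).
  rewrite [LHS](lebesgue_measure_block deg_gt0) => -[] /eqP.
  by rewrite gt_eqF // emp_marg_gt0.
- (* At u = 0, which lies in no block, the series vanishes but the integral need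
     not. *)
  exists [set 0]; split; [exact: measurable_set1|exact: lebesgue_measure_set1|].
  move=> u /= neq_u; apply: contrapT => /eqP u0; apply: neq_u => u01.
  have {u0}u01 : 0 < u <= 1.
    by move: u01; rewrite in_itv /= lt_neqAle eq_sym u0.
  rewrite (grafield_integral deg_gt0) eigen mxE.
  have uB := emp_quantile_mem deg_gt0 u01.
  by rewrite (block_pulse_series_block deg_gt0 _ uB) mulrA.
Qed.
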